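(* Let $n\ge k\ge 0$ be integers with $n-k$ even, and let $\mathcal{I}_{n,k}$ be the set of involutions in $S_n$ with exactly $k$ fixed points, equipped with the descent map $\mathrm{Des}:\mathcal{I}_{n,k}\to 2^{[n-1]}$. If $0<k<n$, then $\mathcal{I}_{n,k}$ carries a (non-Escherian) cyclic descent extension. If $k=0$ or $k=n$, then $\mathcal{I}_{n,k}$ carries only an Escherian cyclic extension of $\mathrm{Des}$ (i.e. it carries an Escherian cyclic extension but no non-Escherian one).
   Context: $[n]=\{1,\dots,n\}$. For $\pi\in S_n$ in one-line notation $[\pi_1,\dots,\pi_n]$, $\mathrm{Des}(\pi)=\{i\in[n-1]:\pi_i>\pi_{i+1}\}$. Given a finite set $\mathcal{T}$ with a map $\mathrm{Des}:\mathcal{T}\to 2^{[n-1]}$, a cyclic extension of $\mathrm{Des}$ is a pair $(\mathrm{cDes},p)$ where $\mathrm{cDes}:\mathcal{T}\to 2^{[n]}$ and $p:\mathcal{T}\to\mathcal{T}$ is a bijection such that for all $T\in\mathcal{T}$: (extension) $\mathrm{cDes}(T)\cap[n-1]=\mathrm{Des}(T)$; (equivariance) $\mathrm{cDes}(p(T))=\{(1+i)\bmod n: i\in \mathrm{cDes}(T)\}$ (residues taken in $[n]$); (non-Escher) $\varnothing\subsetneq\mathrm{cDes}(T)\subsetneq[n]$. A cyclic descent extension (non-Escherian) satisfies all three axioms; a pair satisfying the first two axioms but not the third is an Escherian cyclic extension. *)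

(* Defs.v *)
From mathcomp Require Import all_boot all_fingroup.

Set Implicit Arguments.
Unset Strict Implicit.
Unset Printing Implicit Defensive.

(* Indices are 0-based: the ordinal i : 'I_n stands for the element i + 1 of
   [n] = {1, ..., n}.  A subset of [n-1] is represented as a subset of [n] that
   avoids the last element. *)

(* [n-1] as a subset of [n] *)
Definition interior (n : nat) : {set 'I_n} := [set i : 'I_n | i.+1 < n].

Definition perm_Des (n : nat) (s : 'S_n) : {set 'I_n} :=
  [set i : 'I_n | [exists j : 'I_n, (j == i.+1 :> nat) && (s j < s i)]].

(* [ordS] is the cyclic successor i |-> (i + 1) mod n on 'I_n, which is
   i |-> (1 + i) mod n with residues in [n] after the index shift. *)
Definition cyc_shift (n : nat) (A : {set 'I_n}) : {set 'I_n} :=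
  [set ordS i | i in A].

Section CyclicExtension.

Variables (n : nat) (T : finType) (Des : T -> {set 'I_n}).
Variables (cDes : T -> {set 'I_n}) (p : T -> T).

Definition extension_axiom : Prop :=
  forall x : T, cDes x :&: interior n = Des x.

Definition equivariance_axiom : Prop :=
  forall x : T, cDes (p x) = cyc_shift (cDes x).

Definition non_Escher_axiom : Prop :=
  forall x : T, set0 \proper cDes x /\ cDes x \proper [set: 'I_n].

Definition cyclic_descent_extension : Prop :=
  [/\ bijective p, extension_axiom, equivariance_axiom & non_Escher_axiom].

Definition Escherian_cyclic_extension : Prop :=
  [/\ bijective p, extension_axiom, equivariance_axiom & ~ non_Escher_axiom].

End CyclicExtension.

Definition has_involution_fix (n k : nat) (s : 'S_n) : bool :=
  [forall i, s (s i) == i] && (#|[set i | s i == i]| == k).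

Definition involutions (n k : nat) : finType :=
  {s : 'S_n | has_involution_fix k s}.

Definition involutions_Des (n k : nat) (x : involutions n k) : {set 'I_n} :=
  perm_Des (val x).

(* Main.v *)
(* View an involution as a set of chords on n cyclically ordered points.  Say
   that i is a chord descent if i is matched and either i + 1 is unmatched, or
   i and i + 1 are matched to each other, or their chords cross.  Cyclic chord
   descent sets rotate with the points, and they are nonempty and proper as soon
   as there are both matched and unmatched points.

   Chord descents in [n-1] are equidistributed with ordinary descents.  By
   inclusion-exclusion it is enough to count, for each J, the involutions whose
   descents all lie in J.  Cut [n] into blocks after the elements of J.  For both
   statistics, the condition says that no chord stays inside a block and that
   every block is sorted with respect to the partners of its points, as seen from
   that block; only the order in which a block sees the others, and the direction
   in which the chords between two blocks are paired, differ.  Re-sorting the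
   blocks by conjugation is a bijection between the two kinds of involutions.
   Transporting the chord descents along a bijection that realizes the
   equidistribution gives a cyclic extension of Des for every k.

   For k = n, a cyclic descent set of the identity would be {n} up to rotation.
   For k = 0, the reversal has Des = [n-1], hence its image under p would be a
   fixed-point-free involution with Des = {2, ..., n-1}, and there is none. *)

Require Import Defs.
From mathcomp Require Import all_boot all_fingroup.
From mathcomp Require Import zify.

Set Implicit Arguments.
Unset Strict Implicit.
Unset Printing Implicit Defensive.

(** * Sorting permutations of ['I_n] *)

(** Each ordinal is the number of ordinals below it, and [w] carries those below [x] onto those
    below [w x]. *)
Lemma perm_mono_id (n : nat) (w : 'S_n) :
  (forall x y : 'I_n, x < y -> w x < w y) -> w = 1%g.
Proof.
move=> mono_w.
have lt_w (x y : 'I_n) : (w x < w y) = (x < y).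
  apply/idP/idP; last exact: mono_w.
  case: (ltngtP x y) => // [/mono_w|/val_inj ->]; lia.
apply/permP=> x; rewrite perm1; apply: val_inj.
have cardlt (y : 'I_n) : #|[set z : 'I_n | z < y]| = y.
  rewrite cardsE -sum1_card (big_ord_narrow (ltnW (ltn_ord y))).
  by rewrite /= sum1_card card_ord.
rewrite -[RHS](cardlt x) -[LHS](cardlt (w x)).
rewrite -(card_imset [set z : 'I_n | z < x] (@perm_inj _ w)); apply: eq_card => z.
rewrite -[z](permKV w) (mem_imset _ _ (@perm_inj _ w)) !inE; exact: lt_w.
Qed.

Lemma rank_perm_exists (n : nat) (r : rel 'I_n) :
    irreflexive r -> transitive r -> (forall x y, x != y -> r x y || r y x) ->
  exists w : 'S_n, forall x y, r x y = (w x < w y).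
Proof.
move=> rI rT rC; pose below x := [set z | r z x].
have ltn_below x y : r x y -> #|below x| < #|below y|.
  move=> rxy; apply: proper_card; apply/properP; split.
    by apply/subsetP=> z; rewrite !inE => /rT; apply.
  by exists x; rewrite !inE ?rI.
have rank_lt x : #|below x| < n.
  rewrite -[X in _ < X]card_ord -cardsT; apply: proper_card.
  by apply/properP; split; [apply: subsetT | exists x; rewrite !inE ?rI].
have rank_inj : injective (fun x => Ordinal (rank_lt x)).
  move=> x y /(congr1 val) /= Exy; apply/eqP/negPn/negP=> /rC.
  by case/orP=> /ltn_below; rewrite Exy ltnn.
exists (perm rank_inj) => x y; rewrite !permE /=.
apply/idP/idP=> [/ltn_below // | lt_xy].
have /rC/orP[//|/ltn_below] : x != y by apply: contraTneq lt_xy => ->; rewrite ltnn.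
by move/(ltn_trans lt_xy); rewrite ltnn.
Qed.

(** The default [1%g] is returned only when [r] is not a strict total order. *)
Definition rank_perm (n : nat) (r : rel 'I_n) : 'S_n :=
  odflt 1%g [pick w : 'S_n | [forall x, forall y, r x y == (w x < w y)]].

Lemma rank_permP (n : nat) (r : rel 'I_n) :
    irreflexive r -> transitive r -> (forall x y, x != y -> r x y || r y x) ->
  forall x y, (rank_perm r x < rank_perm r y) = r x y.
Proof.
move=> rI rT rC x y; rewrite /rank_perm.
case: pickP => [w /forallP/(_ x)/forallP/(_ y)/eqP //|].
have [w rw] := rank_perm_exists rI rT rC.
by move/(_ w)/negP; case; apply/forallP=> a; apply/forallP=> b; rewrite rw.
Qed.

(** Both [f] and [f] after [w^-1] are nondecreasing and take the same values with the same
    multiplicities, so their sorted lists of values agree. *)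
Lemma perm_preserves_mono (n : nat) (f : 'I_n -> nat) (w : 'S_n) :
    (forall x y : 'I_n, x <= y -> f x <= f y) ->
    (forall x y, f x < f y -> w x < w y) ->
  forall x, f (w x) = f x.
Proof.
move=> mono_f f_w.
pose g x := f ((w^-1)%g x).
have sorted_image h : (forall x y : 'I_n, x <= y -> h x <= h y) ->
    sorted leq [seq h x | x <- enum 'I_n].
  move=> mono_h; rewrite sorted_map.
  have: sorted leq (map val (enum 'I_n)) by rewrite val_enum_ord iota_sorted.
  rewrite sorted_map; apply: sub_sorted => x y; exact: mono_h.
have mono_g (x y : 'I_n) : x <= y -> g x <= g y.
  move=> le_xy; rewrite leqNgt; apply/negP=> /f_w; rewrite !permKV; lia.
have Efg : [seq f x | x <- enum 'I_n] = [seq g x | x <- enum 'I_n].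
  apply: (sorted_eq leq_trans anti_leq); [exact: sorted_image | exact: sorted_image |].
  have -> : [seq g x | x <- enum 'I_n] = map f (map (w^-1)%g (enum 'I_n)).
    exact: (map_comp f (w^-1)%g).
  apply: perm_map; apply: uniq_perm; rewrite ?(map_inj_uniq perm_inj) ?enum_uniq //.
  move=> x; rewrite mem_enum; apply/esym/mapP; by exists (w x); rewrite ?mem_enum ?permK.
by move=> x; move/eq_in_map: Efg => ->; rewrite ?mem_enum // /g permK.
Qed.

(** * From subset counts to a bijection *)

(** Inclusion-exclusion as strong induction on [#|J|]: the fibers over proper subsets of [J]
    cancel. *)
Lemma card_fiber_of_card_subset (T U : finType) (f g : T -> {set U}) :
    (forall J : {set U}, #|[set x | f x \subset J]| = #|[set x | g x \subset J]|) ->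
  forall J : {set U}, #|[set x | f x == J]| = #|[set x | g x == J]|.
Proof.
move=> Efg J; have [m] := ubnP #|J|; elim: m J => // m IHm J ltJm.
have split_subset (h : T -> {set U}) : #|[set x | h x \subset J]| =
    #|[set x | h x == J]| + \sum_(I : {set U} | I \proper J) #|[set x | h x == I]|.
  rewrite -sum1_card (partition_big h (fun I : {set U} => I \subset J)) /=; last first.
    by move=> x; rewrite inE.
  rewrite (bigD1 J) //=; congr (_ + _).
    rewrite -sum1_card; apply: eq_bigl => x; rewrite !inE.
    by apply: andb_idl => /eqP->.
  apply: eq_big => [I|I /andP[sIJ _]]; first by rewrite properEneq andbC.
  rewrite -sum1_card; apply: eq_bigl => x; rewrite !inE.
  by apply: andb_idl => /eqP->.
have := Efg J; rewrite !split_subset.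
rewrite (eq_bigr (fun I => #|[set x | g x == I]|)); first by move/addIn.
by move=> I /proper_card ltIJ; apply: IHm; lia.
Qed.

(** The lists of values of [f] and [g] over [enum T] are permutations of each other; [h] is the
    permutation of positions. *)
Lemma fiber_bijection (T : finType) (U : eqType) (f g : T -> U) :
    (forall u, #|[set x | f x == u]| = #|[set x | g x == u]|) ->
  exists2 h : T -> T, bijective h & forall x, f (h x) = g x.
Proof.
move=> Efg.
have Eperm : perm_eq [tuple of map g (enum T)] [tuple of map f (enum T)].
  apply/allP=> u _; apply/eqP.
  have Ec (h : T -> U) : count_mem u (map h (enum T)) = #|[set x | h x == u]|.
    rewrite count_map -sum1_count big_enum_cond -sum1_card.
    by apply: eq_bigl => x; rewrite !inE.
  by rewrite [LHS]Ec -Efg; apply/esym/Ec.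
have [p Ep] := tuple_permP Eperm.
exists (fun x => enum_val (p (enum_rank x))).
  exists (fun x => enum_val ((p^-1)%g (enum_rank x))) => x.
    by rewrite enum_valK permK enum_rankK.
  by rewrite enum_valK permKV enum_rankK.
move=> x; have /(congr1 (fun s => nth (g x) s (enum_rank x))) := Ep.
have lt_x : enum_rank x < size (enum T) by rewrite -cardE ltn_ord.
have lt_px : p (enum_rank x) < size (enum T) by rewrite -cardE ltn_ord.
rewrite nth_mktuple (tnth_nth (g x)) /= (nth_map x _ g lt_x) (nth_map x _ f lt_px).
by rewrite nth_enum_rank (enum_val_nth x) => ->.
Qed.

(** * Re-sorting blocks by conjugation *)

Section Resort.

Variables (n : nat) (blk : 'I_n -> nat).
Hypothesis blk_mono : forall x y : 'I_n, x <= y -> blk x <= blk y.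
Hypothesis blk_le : forall x, blk x <= n.

(* The flag [e] selects the view: [true] for ordinary descents, [false] for chord
   descents.  In the latter, block [b] sees the blocks in the order
   b, b - 1, ..., 0, then downwards from the last one to b + 1. *)
Definition block_rank (e : bool) (b c : nat) : nat :=
  if e then c else if c <= b then b - c else b + n.+1 - c.

(* The chords joining two blocks are ordered by their endpoints in the lower block. *)
Definition tie_rank (e : bool) (s : 'S_n) (x : 'I_n) : nat :=
  if blk x <= blk (s x) then nat_of_ord x else if e then nat_of_ord (s x) else n - s x.

(** Comparing own blocks first ensures that sorting by this order moves points only inside their
    blocks. *)
Definition view_lt (e : bool) (s : 'S_n) : rel 'I_n := fun x y =>
  (blk x < blk y) || (blk x == blk y) &&
  ((block_rank e (blk x) (blk (s x)) < block_rank e (blk y) (blk (s y))) ||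
   (block_rank e (blk x) (blk (s x)) == block_rank e (blk y) (blk (s y))) &&
   (tie_rank e s x < tie_rank e s y)).

Definition view_sorted (e : bool) (s : 'S_n) : bool :=
  [forall x : 'I_n, forall y : 'I_n, (x < y) ==> view_lt e s x y]
  && [forall x, (blk (s x) == blk x) ==> (s x == x)].

Lemma view_sortedP (e : bool) (s : 'S_n) :
  reflect ((forall x y : 'I_n, x < y -> view_lt e s x y) /\
           (forall x, blk (s x) = blk x -> s x = x))
          (view_sorted e s).
Proof.
apply: (iffP andP) => -[sorted_s loose_s]; split.
- by move=> x y; move/forallP/(_ x)/forallP/(_ y)/implyP: sorted_s; apply.
- by move=> x /eqP; move/forallP/(_ x)/implyP: loose_s => /[apply]/eqP.
- by apply/forallP=> x; apply/forallP=> y; apply/implyP; apply: sorted_s.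
- by apply/forallP=> x; apply/implyP=> /eqP/loose_s->.
Qed.

(** In the chord view the blocks up to [b] have ranks [0] to [b], and the offset [n.+1] puts the
    later ones at ranks [b.+1] to [n]. *)
Lemma block_rank_inj (e : bool) (b c c' : nat) :
  c <= n -> c' <= n -> block_rank e b c = block_rank e b c' -> c = c'.
Proof.
move=> le_cn le_c'n; rewrite /block_rank; case: e => //.
by case: leqP => ?; case: leqP => ?; lia.
Qed.

Lemma view_lt_irr (e : bool) (s : 'S_n) : irreflexive (view_lt e s).
Proof. by move=> x; rewrite /view_lt !ltnn !andbF. Qed.

Lemma view_lt_trans (e : bool) (s : 'S_n) : transitive (view_lt e s).
Proof. by move=> y x z; rewrite /view_lt; lia. Qed.

Lemma view_lt_total (e : bool) (s : 'S_n) (x y : 'I_n) :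
  x != y -> view_lt e s x y || view_lt e s y x.
Proof.
move=> neq_xy; have neq_val : x != y :> nat by [].
have neq_s : s x != s y :> nat by rewrite (inj_eq val_inj) (inj_eq perm_inj).
rewrite /view_lt; case: (ltngtP (blk x) (blk y)) => //= Eb.
rewrite -Eb; case: (ltngtP (block_rank e _ (blk (s x))) _) => //= /block_rank_inj Ec.
have {}Ec : blk (s x) = blk (s y) by apply: Ec.
rewrite /tie_rank Ec -Eb.
have := ltn_ord (s x); have := ltn_ord (s y).
by case: (leqP (blk x) (blk (s y))); case: e; lia.
Qed.

Definition sorter (e : bool) (s : 'S_n) : 'S_n := rank_perm (view_lt e s).

Lemma sorter_lt (e : bool) (s : 'S_n) (x y : 'I_n) :
  (sorter e s x < sorter e s y) = view_lt e s x y.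
Proof.
apply: rank_permP; [exact: view_lt_irr | exact: view_lt_trans |].
exact: view_lt_total.
Qed.

Lemma blk_sorter (e : bool) (s : 'S_n) (x : 'I_n) : blk (sorter e s x) = blk x.
Proof.
apply: (perm_preserves_mono blk_mono) => u v lt_uv.
by rewrite sorter_lt /view_lt lt_uv.
Qed.

(** At the lower ends of chords joining the same two blocks, both views break ties by position, so
    sorting keeps the order there. *)
Lemma sorter_mono (e : bool) (s : 'S_n) (x y : 'I_n) :
    blk x = blk y -> blk (s x) = blk (s y) -> blk x <= blk (s x) ->
  (sorter e s x < sorter e s y) = (x < y).
Proof.
move=> Eb Ec le_bc; rewrite sorter_lt /view_lt /tie_rank -Ec -Eb.
by rewrite !ltnn !eqxx le_bc.
Qed.

(* Two views break ties by the same end of a chord, so sorting for one view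
   does not disturb the order seen by any other. *)
Lemma view_lt_conj (d e : bool) (s : 'S_n) (x y : 'I_n) :
    involutive s ->
  view_lt d (s ^ sorter e s)%g (sorter e s x) (sorter e s y) = view_lt d s x y.
Proof.
move=> sK; rewrite /view_lt !permJ !blk_sorter.
case: eqP => //= Eb; case: eqP => //= Ec; congr (_ || (_ || _)); move: Ec.
rewrite -Eb => /block_rank_inj Ec; have {}Ec : blk (s x) = blk (s y) by apply: Ec.
rewrite /tie_rank !permJ !blk_sorter -Ec -Eb.
case: (leqP (blk x)) => [le_bc | /ltnW le_cb]; first exact: sorter_mono.
have := ltn_ord (s x); have := ltn_ord (s y).
have := ltn_ord (sorter e s (s x)); have := ltn_ord (sorter e s (s y)).
have : (sorter e s (s x) < sorter e s (s y)) = (s x < s y).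
  by apply: sorter_mono; rewrite ?sK.
have : (sorter e s (s y) < sorter e s (s x)) = (s y < s x).
  by apply: sorter_mono; rewrite ?sK -?Ec -?Eb.
by case: d; lia.
Qed.

Lemma view_sorted_conj (d e : bool) (s : 'S_n) :
  involutive s -> view_sorted d s -> view_sorted e (s ^ sorter e s)%g.
Proof.
move=> sK /view_sortedP[_ loose_s]; apply/view_sortedP; split=> [x y | x].
  rewrite -[x](permKV (sorter e s)) -[y](permKV (sorter e s)).
  by rewrite view_lt_conj // sorter_lt.
rewrite -[x](permKV (sorter e s)) permJ !blk_sorter.
by move/loose_s->.
Qed.

(** By [view_lt_conj] the composite sorts by [view_lt d s], which already agrees with the order of
    the points. *)
Lemma sorterK (d e : bool) (s : 'S_n) :
  involutive s -> view_sorted d s ->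
  (sorter e s * sorter d (s ^ sorter e s) = 1)%g.
Proof.
move=> sK /view_sortedP[sorted_s _]; apply: perm_mono_id => x y lt_xy.
by rewrite !permM sorter_lt view_lt_conj //; apply: sorted_s.
Qed.

Lemma has_involution_fixJ (k : nat) (s w : 'S_n) :
  has_involution_fix k s -> has_involution_fix k (s ^ w)%g.
Proof.
case/andP=> /forallP sK /eqP Ek; apply/andP; split.
  by apply/forallP=> x; rewrite -[x](permKV w) !permJ (eqP (sK _)).
rewrite -Ek -(card_imset [set i | s i == i] (@perm_inj _ w)); apply/eqP/eq_card=> x.
rewrite -[x](permKV w) (mem_imset _ _ (@perm_inj _ w)) !inE permJ.
by rewrite (inj_eq perm_inj).
Qed.

Lemma involutions_involutive (k : nat) (x : involutions n k) : involutive (val x).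
Proof. by case/andP: (valP x) => /forallP sK _ i; apply/eqP. Qed.

Definition conj_involution (k : nat) (x : involutions n k) (w : 'S_n) : involutions n k :=
  Sub (val x ^ w)%g (has_involution_fixJ w (valP x)).

(** Sorting for [e] is injective, because sorting again for [d] undoes it. Exchanging [d] and [e]
    gives equality. *)
Lemma leq_card_view_sorted (k : nat) (d e : bool) :
  #|[set x : involutions n k | view_sorted d (val x)]|
    <= #|[set x : involutions n k | view_sorted e (val x)]|.
Proof.
pose resort (x : involutions n k) := conj_involution x (sorter e (val x)).
have resort_inj : {in [set x : involutions n k | view_sorted d (val x)] &, injective resort}.
  move=> x y; rewrite !inE => sorted_x sorted_y /(congr1 val) /= Exy.
  apply: val_inj.
  rewrite -[LHS]conjg1 -(sorterK e (@involutions_involutive _ x) sorted_x) conjgM Exy.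
  by rewrite -conjgM (sorterK e (@involutions_involutive _ y) sorted_y) conjg1.
rewrite -(card_in_imset resort_inj); apply: subset_leq_card.
apply/subsetP=> _ /imsetP[x + ->]; rewrite !inE => sorted_x /=.
exact: view_sorted_conj (@involutions_involutive _ x) sorted_x.
Qed.

End Resort.

(** * Cutting the points into blocks *)

(** The inequality is strict because a cut comes after its element of [J]. *)
Definition block (n : nat) (J : {set 'I_n}) (x : 'I_n) : nat :=
  #|[set j in J | j < x]|.

Section Blocks.

Variables (n : nat) (J : {set 'I_n}).

Lemma block_mono (x y : 'I_n) : x <= y -> block J x <= block J y.
Proof.
move=> le_xy; apply/subset_leq_card/subsetP=> j; rewrite !inE => /andP[-> /=].
by move/leq_trans; apply.
Qed.

Lemma block_le (x : 'I_n) : block J x <= n.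
Proof. by rewrite -[X in _ <= X]card_ord max_card. Qed.

Lemma block_succ (x y : 'I_n) : y = x.+1 :> nat -> block J y = block J x + (x \in J).
Proof.
move=> Ey; rewrite /block [LHS](cardsD1 x) inE Ey leqnn andbT addnC; congr (_ + _).
by apply: eq_card => j; rewrite !inE -(inj_eq val_inj) /=; case: (j \in J); lia.
Qed.

Lemma block_chain (r : rel 'I_n) :
    transitive r ->
    (forall x y : 'I_n, y = x.+1 :> nat -> x \notin J -> r x y) ->
  forall x y : 'I_n, x < y -> block J x = block J y -> r x y.
Proof.
move=> rT rS x y; have [m] := ubnP (y - x); elim: m x => // m IHm x lt_m lt_xy Eb.
have lt_x1n : x.+1 < n by apply: leq_ltn_trans (ltn_ord y).
pose x1 := Ordinal lt_x1n.
have Eb1 := block_succ (erefl : x1 = x.+1 :> nat).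
have := @block_mono x1 y lt_xy; rewrite Eb1 -Eb => le_b.
have xJ : x \notin J by move: le_b; case: (x \in J) => //; lia.
have r1 : r x x1 by apply: rS.
case: (ltngtP x1 y) => [lt_x1y | /= | /val_inj <-] //; last by lia.
apply: rT r1 (IHm x1 _ lt_x1y _) => /=; first by lia.
by rewrite Eb1 -Eb (negPf xJ) addn0.
Qed.

End Blocks.

Lemma view_lt_of_adjacent (n : nat) (J : {set 'I_n}) (e : bool) (s : 'S_n) :
    (forall x y : 'I_n, y = x.+1 :> nat -> x \notin J -> view_lt (block J) e s x y) ->
  forall x y : 'I_n, x < y -> view_lt (block J) e s x y.
Proof.
move=> ltS x y lt_xy; have := block_mono J (ltnW lt_xy).
rewrite leq_eqVlt => /predU1P[Eb | lt_b]; last by rewrite /view_lt lt_b.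
exact: (block_chain (@view_lt_trans _ _ e s) ltS).
Qed.

(** * Ordinary descents and blocks *)

Section DescentsInsideBlocks.

Variables (n : nat) (J : {set 'I_n}) (s : 'S_n).
Hypothesis sK : involutive s.

(** If all descents lie in [J], then [s] increases on each block; it would reverse the two ends of a
    chord inside a block. *)
Lemma perm_Des_subset : (perm_Des s \subset J) = view_sorted (block J) true s.
Proof.
apply/subsetP/view_sortedP=> [desJ | [sorted_s loose_s] x].
  have incS (x y : 'I_n) : y = x.+1 :> nat -> x \notin J -> s x < s y.
    move=> Ey xJ; have : s x != s y :> nat.
      rewrite (inj_eq val_inj) (inj_eq perm_inj); apply/eqP=> Exy.
      by move: Ey; rewrite Exy; lia.
    have : ~~ (s y < s x); last by lia.
    apply: contra xJ => lt_yx; apply: desJ; rewrite inE.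
    by apply/existsP; exists y; rewrite Ey eqxx.
  have inc (x y : 'I_n) : x < y -> block J x = block J y -> s x < s y.
    by apply: (@block_chain _ _ (fun x y => s x < s y)) => // b a c; apply: ltn_trans.
  split=> [|x Eb]; last first.
    case: (ltngtP x (s x)) => [lt_x | lt_x | /val_inj//].
      by have := inc _ _ lt_x (esym Eb); rewrite sK; lia.
    by have := inc _ _ lt_x Eb; rewrite sK; lia.
  apply: view_lt_of_adjacent => x y Ey xJ.
  have Eb : block J y = block J x by rewrite (block_succ J Ey) (negPf xJ) addn0.
  have lt_s := incS _ _ Ey xJ; have := block_mono J (ltnW lt_s).
  rewrite /view_lt /tie_rank /block_rank Eb ltnn eqxx leq_eqVlt /=.
  case/predU1P=> [<- | ->] //; rewrite ltnn eqxx /=.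
  by case: ifP; rewrite ?lt_s ?Ey.
rewrite inE; apply: contraLR => xJ; apply/existsP=> -[y /andP[/eqP Ey lt_yx]].
have Eb : block J y = block J x by rewrite (block_succ J Ey) (negPf xJ) addn0.
have lt_xy : x < y by lia.
have := sorted_s _ _ lt_xy; have := block_mono J (ltnW lt_yx).
rewrite /view_lt /tie_rank /block_rank Eb ltnn eqxx /= => le_c.
case: ltngtP le_c => //= Ec _; rewrite -Ec.
case: (ltngtP (block J x) (block J (s x))) => [lt_b | _ | Ebs]; last 2 first.
- by lia.
- have Esx : s x = x by apply: loose_s.
  have Esy : s y = y by apply: loose_s; lia.
  by move: lt_yx; rewrite Esx Esy; lia.
(* Both chords go up to the same block, where [s y] precedes [s x]; ties there are broken by the
   lower ends, forcing [y < x]. *)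
have := sorted_s _ _ lt_yx.
rewrite /view_lt /tie_rank /block_rank !sK Eb.
by case: (leqP (block J (s y)) (block J x)) => ? /=;
  case: (leqP (block J (s x)) (block J x)) => ? /=; lia.
Qed.

End DescentsInsideBlocks.

(** * Chord descents and blocks *)

(* The residue of z - j modulo n. *)
Definition cyc_dist (n : nat) (j z : 'I_n) : nat := if j <= z then z - j else z + n - j.

(* For matched i and i + 1, the distance condition holds exactly when they are
   matched to each other or their chords cross. *)
Definition chord_cDes (n : nat) (s : 'S_n) : {set 'I_n} :=
  [set i | (s i != i) &&
     ((s (ordS i) == ordS i) ||
      (cyc_dist (ordS i) (s i) < cyc_dist (ordS i) (s (ordS i))))].

Lemma val_ordS (n : nat) (i : 'I_n) : ordS i = (if i.+1 < n then i.+1 else 0) :> nat.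
Proof.
rewrite /=; case: ltnP => [/modn_small // | le_n].
by have -> : i.+1 = n by [have := ltn_ord i; lia]; rewrite modnn.
Qed.

Lemma cyc_distS (n : nat) (j z : 'I_n) : cyc_dist (ordS j) (ordS z) = cyc_dist j z.
Proof.
rewrite /cyc_dist !val_ordS; have := ltn_ord j; have := ltn_ord z.
by case: (ltnP j.+1 n) => ?; case: (ltnP z.+1 n) => ? ? ?;
  case: (leqP j z) => ?; case: leqP => ?; lia.
Qed.

Definition rotation (n : nat) : 'S_n := perm (@ordS_inj n).

Lemma chord_cDes_rotation (n : nat) (s : 'S_n) :
  chord_cDes (s ^ rotation n)%g = cyc_shift (chord_cDes s).
Proof.
have conjS (i : 'I_n) : (s ^ rotation n)%g (ordS i) = ordS (s i).
  by have := permJ s (rotation n) i; rewrite !permE.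
apply/setP=> i; rewrite -[i]ord_predK (mem_imset _ _ (@ordS_inj n)) !inE.
by rewrite !conjS !cyc_distS !(inj_eq (@ordS_inj n)).
Qed.

Section ChordDescentsInsideBlocks.

Variables (n : nat) (J : {set 'I_n}) (s : 'S_n).
Hypothesis sK : involutive s.

Let in_chord_cDes (x y : 'I_n) : y = x.+1 :> nat ->
  (x \in chord_cDes s) =
    (s x != x) && ((s y == y) || (cyc_dist y (s x) < cyc_dist y (s y))).
Proof.
move=> Ey; suff -> : y = ordS x by rewrite inE.
by apply: val_inj; rewrite [RHS]val_ordS /= -Ey ltn_ord.
Qed.

(** Without a chord descent at a matched [x], the point [x + 1] is matched too, and going forward
    from it one meets its partner before that of [x]. So in a block the fixed points come first,
    then the partners run cyclically backwards, as in [block_rank false]. *)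
Lemma chord_Des_subset :
  (chord_cDes s :&: interior n \subset J) = view_sorted (block J) false s.
Proof.
apply/subsetP/view_sortedP=> [desJ | [sorted_s loose_s] x].
  have desS (x y : 'I_n) : y = x.+1 :> nat -> x \notin J -> s x <> x ->
      s y <> y /\ cyc_dist y (s y) < cyc_dist y (s x).
    move=> Ey xJ /eqP sx; have : x \notin chord_cDes s.
      by apply: contra xJ => des_x; apply: desJ; rewrite inE des_x inE -Ey ltn_ord.
    rewrite (in_chord_cDes Ey) sx /= negb_or -leqNgt => /andP[/eqP sy].
    rewrite leq_eqVlt => /predU1P[Ed|]//; exfalso.
    have: s x != s y :> nat.
      rewrite (inj_eq val_inj) (inj_eq perm_inj); apply/eqP=> Exy.
      by move: Ey; rewrite Exy; lia.
    move: Ed; rewrite /cyc_dist.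
    have := ltn_ord (s x); have := ltn_ord (s y); have := ltn_ord y.
    by case: (leqP y (s x)) => ?; case: (leqP y (s y)) => ?; lia.
  have Eblock (x y : 'I_n) : y = x.+1 :> nat -> x \notin J -> block J y = block J x.
    by move=> Ey xJ; rewrite (block_succ J Ey) (negPf xJ) addn0.
  (* An innermost chord inside a block would cross its neighbour. *)
  have no_chord (x : 'I_n) : x < s x -> block J x <> block J (s x).
    have [m] := ubnP (s x - x); elim: m x => // m IHm x lt_m lt_x Eb.
    have lt_x1n : x.+1 < n by apply: leq_ltn_trans (ltn_ord (s x)).
    pose y := Ordinal lt_x1n; have Ey : y = x.+1 :> nat by [].
    have xJ : x \notin J.
      have := @block_mono _ J y (s x) lt_x; rewrite (block_succ J Ey) -Eb.
      by case: (x \in J) => //; lia.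
    have [|sy lt_d] := desS x y Ey xJ; first by move=> E; move: lt_x; rewrite E ltnn.
    move: lt_d; rewrite /cyc_dist; have := ltn_ord (s x); have := ltn_ord (s y).
    rewrite [y <= s x]lt_x; case: (leqP y (s y)) => [le_y ? ? lt_d | ? ? ?]; last lia.
    have lt_y : y < s y by rewrite ltn_neqAle le_y andbT; apply/eqP=> /val_inj/esym.
    apply: (IHm y) => //; first by lia.
    have := block_mono J (ltnW lt_y); rewrite (Eblock _ _ Ey xJ).
    have := @block_mono _ J (s y) (s x); lia.
  have loose_s x : block J (s x) = block J x -> s x = x.
    move=> Eb; case: (ltngtP x (s x)) => [lt_x | lt_x | /val_inj//].
      by case: (no_chord x).
    by case: (no_chord (s x)); rewrite sK.
  split=> //; apply: view_lt_of_adjacent => x y Ey xJ.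
  have Eb := Eblock _ _ Ey xJ.
  rewrite /view_lt Eb ltnn eqxx /=.
  case: (eqVneq (s x) x) => [Esx | /eqP sx].
    rewrite Esx /tie_rank Esx leqnn subnn Eb.
    case: (ltngtP (block J (s y)) (block J x)) => [?|?|Esy] /=; last by lia.
      by lia.
    have := block_le J x; have := block_le J (s y); lia.
  have [sy lt_d] := desS _ _ Ey xJ sx.
  have bsx : block J (s x) <> block J x by move/loose_s.
  have bsy : block J (s y) <> block J x by rewrite -Eb => /loose_s.
  have mono_s (a b : 'I_n) : block J a < block J b -> a < b.
    by rewrite !ltnNge; apply: contra; apply: block_mono.
  move: lt_d; rewrite /tie_rank /block_rank /cyc_dist Eb.
  have := ltn_ord (s x); have := ltn_ord (s y); have := ltn_ord y.
  have := block_le J x; have := block_le J (s x); have := block_le J (s y).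
  have := mono_s (s x) x; have := mono_s x (s x).
  have := mono_s (s y) y; have := mono_s y (s y).
  have := @block_mono _ J (s x) (s y); have := @block_mono _ J (s y) (s x).
  by case: (leqP y (s x)) => ?; case: (leqP y (s y)) => ?;
    case: (leqP (block J (s x)) (block J x)) => ?;
    case: (leqP (block J x) (block J (s x))) => ?;
    case: (leqP (block J (s y)) (block J x)) => ?;
    case: (leqP (block J x) (block J (s y))) => ?;
    lia.
rewrite inE [x \in interior n]inE => /andP[des_x lt_xn].
apply: contraLR des_x => xJ; pose y := Ordinal lt_xn.
have Ey : y = x.+1 :> nat by [].
have Eb : block J y = block J x by rewrite (block_succ J Ey) (negPf xJ) addn0.
have lt_xy : x < y by lia.
have ord_xy := sorted_s _ _ lt_xy.
rewrite (in_chord_cDes Ey) negb_and negb_or negbK -leqNgt.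
case: (eqVneq (s x) x) => //= sx.
have bsx : block J (s x) <> block J x by move=> /loose_s Esx; rewrite Esx eqxx in sx.
have bsy : block J (s y) <> block J x.
  (* The own block has the least rank, so [x], sorted before [y], would have its partner there as
     well. *)
  move=> Esy; move: ord_xy; rewrite /view_lt /block_rank Eb ltnn eqxx Esy leqnn subnn ltn0 /=.
  by have := block_le J (s x); case: (leqP (block J (s x)) (block J x)) => ?; lia.
apply/andP; split; first by apply/eqP=> Esy; rewrite Esy in bsy.
(* If both partners lie in one higher block, the order at [x] and [y] says nothing about them;
   sortedness at the partners does. *)
have ord_s : s x < s y -> view_lt (block J) false s (s x) (s y) by exact: sorted_s.
move: ord_xy ord_s; rewrite /view_lt /tie_rank /block_rank /cyc_dist !sK Eb.
have := ltn_ord (s x); have := ltn_ord (s y); have := ltn_ord y.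
have := block_le J x; have := block_le J (s x); have := block_le J (s y).
have := @block_mono _ J (s x) x; have := @block_mono _ J x (s x).
have := @block_mono _ J (s y) y; have := @block_mono _ J y (s y); rewrite Eb.
have := @block_mono _ J (s x) (s y); have := @block_mono _ J (s y) (s x).
by case: (leqP y (s x)) => ?; case: (leqP y (s y)) => ?;
  case: (leqP (block J (s x)) (block J x)) => ?;
  case: (leqP (block J x) (block J (s x))) => ?;
  case: (leqP (block J (s y)) (block J x)) => ?;
  case: (leqP (block J x) (block J (s y))) => ?;
  lia.
Qed.

End ChordDescentsInsideBlocks.

(** * Construction of the cyclic extension *)

(** The last clause lets the non-Escher axiom be checked on chord descents alone. *)
Lemma cyclic_extension_exists (n k : nat) :
  exists (cDes : involutions n k -> {set 'I_n}) (p : involutions n k -> involutions n k),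
    [/\ bijective p, extension_axiom (@involutions_Des n k) cDes,
        equivariance_axiom cDes p &
        forall x, exists y : involutions n k, cDes x = chord_cDes (val y)].
Proof.
pose gDes (x : involutions n k) := chord_cDes (val x) :&: interior n.
have Ecard (J : {set 'I_n}) : #|[set x | gDes x \subset J]| =
    #|[set x | @involutions_Des n k x \subset J]|.
  have Eg : [set x | gDes x \subset J] =
      [set x : involutions n k | view_sorted (block J) false (val x)].
    by apply/setP=> x; rewrite !inE -(chord_Des_subset J (@involutions_involutive _ _ x)).
  have Ed : [set x | @involutions_Des n k x \subset J] =
      [set x : involutions n k | view_sorted (block J) true (val x)].
    by apply/setP=> x; rewrite !inE -(perm_Des_subset J (@involutions_involutive _ _ x)).
  by rewrite Eg Ed; apply/eqP; rewrite eqn_leq !leq_card_view_sorted //;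
    first [exact: block_mono | exact: block_le].
have [h [h' hK h'K] Eh] := fiber_bijection (card_fiber_of_card_subset Ecard).
pose rot (x : involutions n k) := conj_involution x (rotation n).
(* Rotation acts on chord descents, so it is pulled back along [h]. *)
exists (fun x => chord_cDes (val (h x))), (h' \o rot \o h); split.
- apply: injF_bij => x y /(can_inj h'K) /(congr1 val) /= /(can_inj (conjgK _)).
  by move/val_inj/(can_inj hK).
- by move=> x; apply: Eh.
- by move=> x; rewrite /= h'K chord_cDes_rotation.
- by move=> x; exists (h x).
Qed.

(** * The non-Escher axiom and the extreme cases *)

Lemma ordS_invariant (n : nat) (P : pred 'I_n) :
  (forall i, P i -> P (ordS i)) -> forall i j, P i -> P j.
Proof.
move=> PS i j Pi.
have iterS m : val (iter m (@ordS n) i) = (i + m) %% n.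
  elim: m => [|m IHm]; first by rewrite addn0 modn_small.
  by rewrite iterS /= IHm addnS -addn1 modnDml addn1.
(* Adding [n] keeps the truncated subtraction exact when [j < i]. *)
have -> : j = iter (j + n - i) (@ordS n) i.
  apply: val_inj; rewrite iterS subnKC; last by have := ltn_ord i; lia.
  by rewrite modnDr modn_small.
by elim: (j + n - i) => //= m; apply: PS.
Qed.

(** With no chord descent, being matched would spread from [b] around the cycle to [a]; and the
    fixed point [a] is never a chord descent. *)
Lemma chord_cDes_proper (n : nat) (s : 'S_n) (a b : 'I_n) :
    s a = a -> s b <> b ->
  set0 \proper chord_cDes s /\ chord_cDes s \proper [set: 'I_n].
Proof.
move=> sa sb; rewrite properT; split.
  rewrite proper0; apply/negP=> /eqP cDes0.
  suff : s a != a by rewrite sa eqxx.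
  apply: (@ordS_invariant _ (fun i => s i != i) _ b); last by apply/eqP.
  move=> i si; move/setP/(_ i): cDes0; rewrite !inE si /=.
  by move/negbT; rewrite negb_or => /andP[].
apply/negP=> /eqP/setP/(_ a); by rewrite !inE sa eqxx.
Qed.

Lemma full_fix_perm (n : nat) (s : 'S_n) : has_involution_fix n s -> s = 1%g.
Proof.
case/andP=> _ /eqP Ecard; apply/permP=> i; rewrite perm1.
have : [set i | s i == i] == [set: 'I_n].
  by rewrite eqEcard subsetT cardsT card_ord Ecard leqnn.
by move/eqP/setP/(_ i); rewrite !inE => /eqP.
Qed.

Lemma identity_no_cyclic_descents (n : nat)
    (cDes : involutions n n -> {set 'I_n}) (p : involutions n n -> involutions n n) :
  ~ cyclic_descent_extension (@involutions_Des n n) cDes p.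
Proof.
case=> _ ext equi nonE.
have id_fix : has_involution_fix n (1%g : 'S_n).
  apply/andP; split; first by apply/forallP=> i; rewrite !perm1.
  rewrite -[X in _ == X]card_ord -cardsT; apply/eqP/eq_card=> i.
  by rewrite !inE perm1 eqxx.
have last (y : involutions n n) (j : 'I_n) : j \in cDes y -> n <= j.+1.
  move=> jy; rewrite leqNgt; apply/negP=> lt_jn.
  have : j \in cDes y :&: interior n by rewrite inE jy inE lt_jn.
  rewrite ext /involutions_Des (full_fix_perm (valP y)) inE.
  by case/existsP=> i; rewrite !perm1; lia.
pose x : involutions n n := Sub (1%g : 'S_n) id_fix.
have [/properP[_ [j jx _]] /properP[_ [z _ zx]]] := nonE x.
have le_nj := last _ _ jx.
have : ordS j \in cDes (p x) by rewrite equi; apply: imset_f.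
(* The shift takes the last point to the first, so [n = 1], where a nonempty set is full. *)
move/last; rewrite val_ordS ltnNge le_nj /= => le_n1.
suff Ezj : z = j by rewrite Ezj jx in zx.
by apply: val_inj => /=; have := ltn_ord z; have := ltn_ord j; lia.
Qed.

Lemma matchings_no_cyclic_descents (n : nat)
    (cDes : involutions n 0 -> {set 'I_n}) (p : involutions n 0 -> involutions n 0) :
  0 < n -> ~~ odd n -> ~ cyclic_descent_extension (@involutions_Des n 0) cDes p.
Proof.
move=> n_gt0 even_n [_ ext equi nonE].
have lt1n : 1 < n by case: n n_gt0 even_n {cDes p ext equi nonE} => [|[]].
pose rev_perm : 'S_n := perm (@rev_ord_inj n).
have rev_fix : has_involution_fix 0 rev_perm.
  apply/andP; split; first by apply/forallP=> i; rewrite !permE rev_ordK.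
  rewrite cards_eq0; apply/eqP/setP=> i; rewrite !inE permE.
  apply/negP=> /eqP/(congr1 val) /=; have := ltn_ord i; lia.
pose x : involutions n 0 := Sub rev_perm rev_fix.
have interior_x (j : 'I_n) : j.+1 < n -> j \in cDes x.
  move=> lt_jn; have : j \in involutions_Des x.
    rewrite inE; apply/existsP; exists (Ordinal lt_jn); rewrite eqxx /= !permE /=.
    by have := ltn_ord j; lia.
  by rewrite -ext inE => /andP[].
have [_ /properP[_ [z _ zx]]] := nonE x.
have Ez : z.+1 = n.
  apply/eqP; rewrite eqn_leq ltn_ord leqNgt; apply: contra zx; exact: interior_x.
pose s := val (p x).
(* [cDes x] misses only the last point, so its shift misses only the first. *)
have inDes (i : 'I_n) : i.+1 < n -> (i \in perm_Des s) = (i != 0 :> nat).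
  move=> lt_in; rewrite -[perm_Des s]ext inE [i \in interior n]inE lt_in andbT equi.
  rewrite -[i in LHS]ord_predK (mem_imset _ _ (@ordS_inj n)).
  have Ei := val_ordS (ord_pred i); rewrite ord_predK in Ei.
  have [Ei0 | i_gt0] := posnP i.
    suff -> : ord_pred i = z by rewrite (negPf zx).
    apply: val_inj => /=; move: Ei; case: ltnP => //=; lia.
  by rewrite interior_x; move: Ei; case: ltnP => //=; lia.
have sK : involutive s := @involutions_involutive _ _ (p x).
pose i0 : 'I_n := Ordinal n_gt0; pose i1 : 'I_n := Ordinal lt1n.
have s0 : s i0 <> i0.
  case/andP: (valP (p x)) => _; rewrite cards_eq0 => /eqP/setP/(_ i0).
  by rewrite !inE => /eqP.
(* There is no descent at [s i0], whose image is the minimum; hence [s i0] is last, which makes [i0]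
   a descent. *)
have s0_last : n <= (s i0).+1.
  rewrite leqNgt; apply/negP=> lt_s0.
  have : s i0 \in perm_Des s.
    by rewrite inDes //; apply/eqP=> E; apply: s0; apply: val_inj.
  by rewrite inE => /existsP[j /andP[_]]; rewrite sK.
have /negP[] : i0 \notin perm_Des s by rewrite inDes.
rewrite inE; apply/existsP; exists i1.
rewrite eqxx /=; have : s i1 != s i0 :> nat by rewrite (inj_eq val_inj) (inj_eq perm_inj).
by have := ltn_ord (s i1); lia.
Qed.

Theorem theorem1p6 (n k : nat) (hkn : k <= n) (hparity : ~~ odd (n - k)) :
  (0 < k < n ->
     exists (cDes : involutions n k -> {set 'I_n})
            (p : involutions n k -> involutions n k),
       cyclic_descent_extension (@involutions_Des n k) cDes p)
  /\
  (k = 0 \/ k = n ->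
     (exists (cDes : involutions n k -> {set 'I_n})
             (p : involutions n k -> involutions n k),
        Escherian_cyclic_extension (@involutions_Des n k) cDes p)
     /\
     ~ (exists (cDes : involutions n k -> {set 'I_n})
               (p : involutions n k -> involutions n k),
          cyclic_descent_extension (@involutions_Des n k) cDes p)).
Proof.
have [cDes [p [p_bij ext equi cDes_chord]]] := cyclic_extension_exists n k.
split=> [/andP[k_gt0 lt_kn] | k_extreme].
  exists cDes, p; split=> // x; have [y ->] := cDes_chord x.
  case/andP: (valP y) => _ /eqP Ek.
  have /card_gt0P[a] : 0 < #|[set i | val y i == i]| by rewrite Ek.
  rewrite inE => /eqP ya.
  have [b yb] : exists b, val y b <> b.
    have : ~: [set i | val y i == i] != set0.
      by rewrite -card_gt0 cardsCs setCK card_ord Ek subn_gt0.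
    by case/set0Pn=> b; rewrite !inE => /eqP; exists b.
  exact: chord_cDes_proper ya yb.
have no_ext cDes' p' : ~ cyclic_descent_extension (@involutions_Des n k) cDes' p'.
  (* Treating [k = n] first absorbs [n = 0], so that [0 < n] holds for matchings. *)
  case: (eqVneq k n) k_extreme => [Ekn _ | /eqP neq_kn [Ek0 | //]].
    by subst k; apply: identity_no_cyclic_descents.
  by subst k; apply: matchings_no_cyclic_descents; [lia | rewrite subn0 in hparity].
split; last by case=> cDes' [p'] /no_ext.
by exists cDes, p; split=> // nonE; apply: (no_ext cDes p); split.
Qed.
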